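(* Let $I$ be a finite set. A submodular function $f:2^I\to\mathbb R$ is relational if and only if either of the following conditions holds: (1) its associated polytope $\mathcal P(f)$ is hypergraphic; (2) $f(\emptyset)=0$, and for all $A\subseteq I$ we have $f(A)\in\mathbb Z$ and $$\sum_{K\supseteq A}(-1)^{|K-A|}f(K)\le0,$$ the sum being over all $K$ with $A\subseteq K\subseteq I$.
   Context: A function $f:2^I\to\mathbb R$ with $f(\emptyset)=0$ is submodular if $f(A\cup B)+f(A\cap B)\le f(A)+f(B)$ for all $A,B\subseteq I$. Its associated (base) polytope is $\mathcal P(f)=\{x\in\mathbb RI:\sum_{i\in I}x_i=f(I),\ \sum_{i\in A}x_i\le f(A)\text{ for all }A\subseteq I\}$, where $\mathbb RI$ is the real vector space with basis $\{e_i\}_{i\in I}$. The function $f$ is relational if there are a finite set $J$ and a relation $R\subseteq I\times J$ with $f=f_R$, where $f_R(A)=|\{b\in J:(a,b)\in R\text{ for some }a\in A\}|$ for $A\subseteq I$. A polytope in $\mathbb RI$ is hypergraphic if it is a Minkowski sum $\sum_{\emptyset\ne J\subseteq I}y(J)\Delta_J$ with $y(J)$ nonnegative integers, where $\Delta_J=\mathrm{conv}\{e_i:i\in J\}$.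
   Formalization: In condition (2) the inequality is required only for A ≠ I: at A = I the printed sum is f(I), and f(I) ≤ 0 fails for every nonzero relational f (for example I a single point, f(A)=|A|). Each of (1) and (2) is shown equivalent to f being relational. *)

(* Defs.v *)
From HB Require Import structures.
From mathcomp Require Import all_boot all_order all_algebra.
From mathcomp Require Import boolp classical_sets reals.

Set Implicit Arguments.
Unset Strict Implicit.
Unset Printing Implicit Defensive.

Import Order.TTheory GRing.Theory Num.Theory.
Local Open Scope ring_scope.

(* [set x | P] is a Prop-valued set of classical_sets under %classic, and a
   finite set {set T} under %SET.  The vector space RI is {ffun I -> R^o}: R^o
   is R seen as a module over itself, which makes the scaling available. *)

Definition submodular (R : realType) (I : finType) (f : {set I} -> R) : Prop :=
  f finset.set0 = 0 /\
  forall A B : {set I}, f (A :|: B) + f (A :&: B) <= f A + f B.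

Definition base_polytope (R : realType) (I : finType) (f : {set I} -> R) :
    set {ffun I -> R^o} :=
  [set x : {ffun I -> R^o} | \sum_i x i = f finset.setT /\
    forall A : {set I}, \sum_(i in A) x i <= f A]%classic.

Definition relation_fun (R : realType) (I J : finType) (r : I -> J -> bool)
    (A : {set I}) : R :=
  #|[set b : J | [exists a in A, r a b]]%SET|%:R.

Definition relational (R : realType) (I : finType) (f : {set I} -> R) : Prop :=
  exists (J : finType) (r : I -> J -> bool), f = @relation_fun R I J r.

Definition conv_hull (R : realType) (V : lmodType R) (X : set V) : set V :=
  [set x : V | exists (n : nat) (p : 'I_n -> V) (w : 'I_n -> R),
    [/\ forall k, X (p k), forall k, 0 <= w k, \sum_k w k = 1
      & x = \sum_k w k *: p k]]%classic.

Definition dilate (R : realType) (V : lmodType R) (c : R) (X : set V) : set V :=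
  [set c *: x | x in X]%classic.

(* The empty Minkowski sum is the point 0. *)
Definition minkowski_sum (R : realType) (V : lmodType R) (S : finType)
    (P : pred S) (X : S -> set V) : set V :=
  [set x : V | exists2 v : S -> V,
    forall s, P s -> X s (v s) & x = \sum_(s | P s) v s]%classic.

Definition basis_vec (R : realType) (I : finType) (i : I) : {ffun I -> R^o} :=
  [ffun j => (j == i)%:R].

Definition simplex (R : realType) (I : finType) (J : {set I}) :
    set {ffun I -> R^o} :=
  conv_hull [set basis_vec R i | i in [set` J]]%classic.

Definition hypergraphic (R : realType) (I : finType) (X : set {ffun I -> R^o}) :
    Prop :=
  exists y : {set I} -> nat,
    X = minkowski_sum (fun J : {set I} => J != finset.set0)
          (fun J : {set I} => dilate (y J)%:R (@simplex R I J)).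

(* A = I is excluded from the inequality: there the sum is just f(I), which is
   positive for every relational f <> 0. *)
Definition integral_alternating (R : realType) (I : finType)
    (f : {set I} -> R) : Prop :=
  f finset.set0 = 0 /\
  forall A : {set I}, f A \is a Num.int /\
    (A != finset.setT ->
      \sum_(K : {set I} | A \subset K) (-1) ^+ #|K :\: A| * f K <= 0).

(* Main.v *)
Require Import Defs.
From mathcomp Require Import all_boot all_order all_algebra.
From mathcomp Require Import boolp classical_sets reals.
From mathcomp Require Import fintype finset lra.
Import Order.TTheory GRing.Theory Num.Theory.
Local Open Scope ring_scope.

(** A relation from I to J matters for f_R only through its fibres
    {a : (a, b) in R}, which form a multiset of subsets of I.  If y(S) counts
    the b whose fibre is S, then f_R(A) is the sum of y(S) over the S that meet
    A, and every y : 2^I -> nat arises in this way.  So the relational functions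
    are the functions [hypergraph_rank y], and both equivalences are about these.

    Polytopes.  The base polytope of [hypergraph_rank y] is the Minkowski sum of
    the y(S) Delta_S ([base_polytope_hypergraph_rank]).  That the sum lies in
    the polytope is a direct estimate.  Conversely, a point x of the polytope is
    nonnegative, and its inequalities are the Hall condition for shipping the
    amount x_i from each i to hyperedges S containing i, the capacity of S being
    y(S).  By the real-weighted Hall theorem [fractional_hall] a transport plan
    exists; since the total supply equals the total capacity of the nonempty
    hyperedges, the plan saturates each of them, and its column at S is a point
    of y(S) Delta_S.  This gives one implication.  For the other, a submodular
    function is determined by its base polytope ([base_polytope_inj]), because
    each inequality x(A) <= f(A) is tight somewhere, as the greedy algorithm
    shows ([base_polytope_tight]).

    Alternating sums.  Let s(A) be the sum of (-1)^|K - A| f(K) over K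
    containing A.  Moebius inversion on the Boolean lattice recovers f(A) as the
    sum of s(B) over B containing A.  For f = [hypergraph_rank y] and A <> I one
    finds s(A) = - y(I - A), which is an integer and at most 0.  Conversely, if
    the s(A) with A <> I are integers at most 0, then y(S) = - s(I - S) are
    natural numbers, and Moebius inversion together with f(set0) = 0 says that f is
    [hypergraph_rank y]. *)

(** * A Hall theorem for real supplies and capacities *)

Definition nbhd_weight {R : nmodType} {I J : finType} (r : I -> J -> bool)
    (y : J -> R) (A : {set I}) : R :=
  \sum_(j | [exists i in A, r i j]) y j.

(** Supplies x must be shipped in full, while capacities y are only upper
    bounds: the inequality on the columns is what survives when a plan is
    assembled from plans for parts of the data. *)
Definition transportable {R : numDomainType} {I J : finType}
    (r : I -> J -> bool) (x : I -> R) (y : J -> R) : Prop :=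
  exists t : I -> J -> R,
    [/\ forall i j, 0 <= t i j, forall i j, ~~ r i j -> t i j = 0,
        forall i, \sum_j t i j = x i & forall j, \sum_i t i j <= y j].

Lemma transportableD {R : numDomainType} {I J : finType} (r : I -> J -> bool)
    (x x1 x2 : I -> R) (y y1 y2 : J -> R) :
  (forall i, x i = x1 i + x2 i) -> (forall j, y j = y1 j + y2 j) ->
  transportable r x1 y1 -> transportable r x2 y2 -> transportable r x y.
Proof.
move=> xE yE [t1 [t1_ge0 t1r t1x t1y]] [t2 [t2_ge0 t2r t2x t2y]].
exists (fun i j => t1 i j + t2 i j); split=> [i j|i j nrij|i|j].
- exact: addr_ge0.
- by rewrite t1r // t2r // addr0.
- by rewrite big_split /= t1x t2x xE.
- by rewrite big_split /= yE lerD.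
Qed.

Lemma sum_delta {R : nmodType} {T : finType} (P : pred T) (t0 : T) (e : R) :
  \sum_(t | P t) (if t == t0 then e else 0) = if P t0 then e else 0.
Proof. by rewrite -big_mkcondr big_mkcondl big_pred1_eq. Qed.

Lemma transportable_edge {R : numDomainType} {I J : finType}
    (r : I -> J -> bool) (i0 : I) (j0 : J) (e : R) :
  0 <= e -> r i0 j0 ->
  transportable r (fun i => if i == i0 then e else 0)
                  (fun j => if j == j0 then e else 0).
Proof.
move=> e_ge0 r00.
exists (fun i j => if (i == i0) && (j == j0) then e else 0).
split=> [i j|i j|i|j].
- by case: ifP.
- by case: ifP => // /andP[/eqP-> /eqP->]; rewrite r00.
- by case: (i == i0) => /=; rewrite ?sum_delta ?big1.
- by under eq_bigr do rewrite andbC; case: (j == j0) => /=;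
    rewrite ?sum_delta ?big1.
Qed.

Lemma nbhdS {I J : finType} (r : I -> J -> bool) (A B : {set I}) (j : J) :
  A \subset B -> [exists i in A, r i j] -> [exists i in B, r i j].
Proof.
move=> /subsetP sAB /exists_inP[i iA rij].
by apply/exists_inP; exists i; first exact: sAB.
Qed.

Lemma nbhdU {I J : finType} (r : I -> J -> bool) (A B : {set I}) (j : J) :
  [exists i in A :|: B, r i j] = [exists i in A, r i j] || [exists i in B, r i j].
Proof.
apply/idP/orP => [/exists_inP[i]|[]]; last 2 first.
- exact/nbhdS/subsetUl.
- exact/nbhdS/subsetUr.
by rewrite inE => /orP[] iA rij; [left|right]; apply/exists_inP; exists i.
Qed.

Lemma ler_nbhd_weight {R : numDomainType} {I J : finType} (r : I -> J -> bool)
    (y : J -> R) (A B : {set I}) :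
  (forall j, 0 <= y j) -> A \subset B -> nbhd_weight r y A <= nbhd_weight r y B.
Proof.
move=> y_ge0 sAB; rewrite /nbhd_weight.
rewrite [leLHS]big_mkcond [leRHS]big_mkcond; apply: ler_sum => j _ /=.
by case: ifP => [/(nbhdS r _ _ _ sAB)->|_] //; case: ifP.
Qed.

Lemma ltn_support {R : nmodType} {T : finType} (x x' : T -> R) (t0 : T) :
  (forall t, x t = 0 -> x' t = 0) -> x t0 != 0 -> x' t0 = 0 ->
  (#|support x'| < #|support x|)%N.
Proof.
move=> xx' x0 x'0; apply: proper_card; apply/properP; split.
  by apply/subsetP => t; rewrite !inE; apply: contra => /eqP/xx'->.
by exists t0; rewrite !inE ?x'0 ?eqxx.
Qed.

Lemma leq_support {R : nmodType} {T : finType} (x x' : T -> R) :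
  (forall t, x t = 0 -> x' t = 0) ->
  (#|support x'| <= #|support x|)%N.
Proof.
move=> xx'; apply: subset_leq_card.
by apply/subsetP => t; rewrite !inE; apply: contra => /eqP/xx'->.
Qed.

(** The Hall condition passes to a set A of sources and its neighbourhood,
    because the neighbourhood of B :&: A lies in those of A and of B.  Part of
    the data is discarded by setting it to zero, so that no type has to change. *)
Lemma hall_restrict {R : numDomainType} {I J : finType} (r : I -> J -> bool)
    (x : I -> R) (y : J -> R) (A : {set I}) :
  (forall j, 0 <= y j) ->
  (forall B : {set I}, \sum_(i in B) x i <= nbhd_weight r y B) ->
  forall B : {set I}, \sum_(i in B) (if i \in A then x i else 0) <=
    nbhd_weight r (fun j => if [exists i in A, r i j] then y j else 0) B.
Proof.
move=> y_ge0 hall B; rewrite -big_mkcondr /nbhd_weight -big_mkcondr /=.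
have -> : \sum_(i in B | i \in A) x i = \sum_(i in B :&: A) x i.
  by apply: eq_bigl => i; rewrite inE.
apply: le_trans (hall _) _; rewrite /nbhd_weight.
rewrite [leLHS]big_mkcond [leRHS]big_mkcond; apply: ler_sum => j _ /=.
case: ifP => [N|_]; last by case: ifP.
by rewrite (nbhdS _ _ _ _ (subsetIl B A) N) (nbhdS _ _ _ _ (subsetIr B A) N).
Qed.

(** If A is tight, then A and its neighbourhood can be removed together: the
    condition for A :|: B minus the equality for A is the condition for B in
    what remains. *)
Lemma hall_contract {R : numDomainType} {I J : finType} (r : I -> J -> bool)
    (x : I -> R) (y : J -> R) (A : {set I}) :
  (forall B : {set I}, \sum_(i in B) x i <= nbhd_weight r y B) ->
  \sum_(i in A) x i = nbhd_weight r y A ->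
  forall B : {set I}, \sum_(i in B) (if i \in A then 0 else x i) <=
    nbhd_weight r (fun j => if [exists i in A, r i j] then 0 else y j) B.
Proof.
move=> hall tight B; have := hall (A :|: B); rewrite /nbhd_weight.
rewrite (bigID (mem A)) /= [leRHS](bigID (fun j => [exists i in A, r i j])) /=.
rewrite (eq_bigl (mem A)); last first.
  by move=> i; rewrite /= inE; case: (i \in A); rewrite ?andbF.
rewrite [X in _ <= X + _](eq_bigl (fun j => [exists i in A, r i j])); last first.
  by move=> j; rewrite nbhdU; case: [exists i in A, _]; rewrite ?andbF.
rewrite tight lerD2l => H.
under eq_bigr do rewrite -if_neg; under [leRHS]eq_bigr do rewrite -if_neg.
rewrite -!big_mkcondr /=; move: H; congr (_ <= _); apply: eq_bigl => i.
  by rewrite inE; case: (i \in A); rewrite ?andbF.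
by rewrite nbhdU; case: [exists i0 in A, _]; rewrite ?andbF.
Qed.

(** Induction on the number of nonzero supplies and capacities.  Push as much
    as the Hall condition allows along one edge from i0 to j0.  A set A loses
    slack exactly when it misses i0 while its neighbourhood contains j0.  So the
    push stops either because x i0 or y j0 is used up, or because such an A
    becomes tight; then the problem splits into A with its neighbourhood, where
    i0 is gone, and the rest, where j0 is gone.  Unlike an augmenting path
    argument, this terminates for real data. *)
Theorem fractional_hall {R : realFieldType} {I J : finType}
    (r : I -> J -> bool) (x : I -> R) (y : J -> R) :
  (forall i, 0 <= x i) -> (forall j, 0 <= y j) ->
  (forall A : {set I}, \sum_(i in A) x i <= nbhd_weight r y A) ->
  transportable r x y.
Proof.
have [n] := ubnP (#|support x| + #|support y|).
elim: n x y => // n IH x y; rewrite ltnS => le_n x_ge0 y_ge0 hall.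
have [i0 x0 | x0] := pickP (fun i => x i != 0); last first.
  exists (fun _ _ => 0); split=> // [i|j]; rewrite big1 //.
  by have /eqP := x0 i.
have [j0 /andP[r00 y0] | yN] := pickP (fun j => r i0 j && (y j != 0)); last first.
  case/negP: x0; rewrite eq_le x_ge0 andbT.
  have := hall [set i0]%SET; rewrite big_set1 => /le_trans; apply.
  rewrite /nbhd_weight big1 // => j /exists_inP[i /set1P-> rij].
  by have := yN j; rewrite rij => /negbFE/eqP.
(* The sets that are not critical get the other bound on the push, so that the
   minimum over all sets is the largest admissible amount e; the empty set is
   one of them, which gives e <= x i0 and e <= y j0. *)
pose crit (A : {set I}) := (i0 \notin A) && [exists i in A, r i j0].
pose slack (A : {set I}) :=
  if crit A then nbhd_weight r y A - \sum_(i in A) x i else Num.min (x i0) (y j0).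
have [/= A _ slackA] := @arg_minP _ _ _ set0 xpredT slack isT.
set e := slack A in slackA.
have e_min : (e <= x i0) && (e <= y j0).
  rewrite -le_min; have := slackA set0 isT; rewrite /slack /crit.
  by case: ifP => // /andP[_ /exists_inP[i]]; rewrite inE.
have /andP[e_x e_y] := e_min.
have e_ge0 : 0 <= e.
  by rewrite /e /slack; case: ifP; rewrite ?subr_ge0 // le_min x_ge0 y_ge0.
pose x' i := x i - (if i == i0 then e else 0).
pose y' j := y j - (if j == j0 then e else 0).
have sx' (B : {set I}) :
    \sum_(i in B) x' i = \sum_(i in B) x i - (if i0 \in B then e else 0).
  by rewrite sumrB sum_delta.
have sy' B : nbhd_weight r y' B =
    nbhd_weight r y B - (if [exists i in B, r i j0] then e else 0).
  by rewrite /nbhd_weight sumrB sum_delta.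
have x'_ge0 i : 0 <= x' i.
  by rewrite /x'; case: eqP => [->|_]; rewrite ?subr_ge0 // subr0.
have y'_ge0 j : 0 <= y' j.
  by rewrite /y'; case: eqP => [->|_]; rewrite ?subr_ge0 // subr0.
have x'0 i : x i = 0 -> x' i = 0.
  rewrite /x'; case: eqP => [->|_ ->]; last by rewrite subr0.
  by move=> xi; rewrite xi eqxx in x0.
have y'0 j : y j = 0 -> y' j = 0.
  rewrite /y'; case: eqP => [->|_ ->]; last by rewrite subr0.
  by move=> yj; rewrite yj eqxx in y0.
have hall' (B : {set I}) : \sum_(i in B) x' i <= nbhd_weight r y' B.
  rewrite sx' sy'; have := slackA B isT; have := hall B; rewrite /slack /crit.
  have [iB|iB] /= := boolP (i0 \in B).
    have -> : [exists i in B, r i j0] by apply/exists_inP; exists i0.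
    by move=> hB _; rewrite lerD2r.
  by case: ifP => _ hB hA; rewrite ?subr0 //; lra.
apply: (transportableD r x (fun i => if i == i0 then e else 0) x'
  y (fun j => if j == j0 then e else 0) y').
- by move=> i; rewrite addrC subrK.
- by move=> j; rewrite addrC subrK.
- exact: transportable_edge.
have [/andP[iA jA]|ncA] := boolP (crit A); last first.
  apply: IH => //; apply: leq_trans le_n.
  have eE : e = Num.min (x i0) (y j0) by rewrite /e /slack (negbTE ncA).
  have [xe|ye] : x i0 = e \/ y j0 = e.
    by rewrite eE; case: leP; [left|right].
    rewrite -addSn leq_add ?leq_support // (ltn_support _ _ i0) //.
    by rewrite /x' eqxx xe subrr.
  rewrite -addnS leq_add ?leq_support // (ltn_support _ _ j0) //.
  by rewrite /y' eqxx ye subrr.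
have tight : \sum_(i in A) x' i = nbhd_weight r y' A.
  rewrite sx' sy' (negbTE iA) jA subr0.
  by rewrite /e /slack /crit iA jA /= opprB addrC subrK.
apply: (transportableD r x' (fun i => if i \in A then x' i else 0)
    (fun i => if i \in A then 0 else x' i)
    y' (fun j => if [exists i in A, r i j] then y' j else 0)
    (fun j => if [exists i in A, r i j] then 0 else y' j)).
- by move=> i; case: ifP; rewrite ?addr0 ?add0r.
- by move=> j; case: ifP; rewrite ?addr0 ?add0r.
- apply: IH; [|by move=> i; case: ifP|by move=> j; case: ifP
    |exact: hall_restrict].
  apply: leq_trans le_n; rewrite -addSn leq_add //.
    rewrite (ltn_support _ _ i0) ?(negbTE iA) //.
    by move=> i /x'0 ->; case: ifP.
  by apply: leq_support => j /y'0->; case: ifP.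
- apply: IH; [|by move=> i; case: ifP|by move=> j; case: ifP
    |exact: hall_contract].
  apply: leq_trans le_n; rewrite -addnS leq_add //.
    by apply: leq_support => i /x'0->; case: ifP.
  rewrite (ltn_support _ _ j0) ?jA //.
  by move=> j /y'0->; case: ifP.
Qed.

(** * Relational functions as hypergraph rank functions *)

Lemma nbhd_weight_submodular {R : realType} {I J : finType}
    (r : I -> J -> bool) (y : J -> R) :
  (forall j, 0 <= y j) -> submodular (nbhd_weight r y).
Proof.
move=> y_ge0; split=> [|A B].
  by rewrite /nbhd_weight big1 // => j /exists_inP[i]; rewrite inE.
rewrite /nbhd_weight !(big_mkcond (fun j => [exists i in _, r i j])) -!big_split /=.
apply: ler_sum => j _; rewrite nbhdU.
have [N|_] := boolP [exists i in A :&: B, r i j].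
  by rewrite (nbhdS _ _ _ _ (subsetIl A B) N) (nbhdS _ _ _ _ (subsetIr A B) N).
have := y_ge0 j.
by case: [exists i in A, r i j]; case: [exists i in B, r i j] => /=; lra.
Qed.

Definition hypergraph_rank (R : pzRingType) {I : finType}
    (y : {set I} -> nat) : {set I} -> R :=
  nbhd_weight (fun i (J : {set I}) => i \in J) (fun J => (y J)%:R).

(** Meeting is expressed through non-inclusion in the complement because the
    alternating sums below range over intervals of the Boolean lattice. *)
Lemma meetsE {I : finType} (A J : {set I}) :
  [exists i in A, i \in J] = ~~ (A \subset ~: J).
Proof.
rewrite -disjoints_subset -setI_eq0.
apply/exists_inP/set0Pn => [[i iA iJ]|[i /setIP[]]]; exists i => //.
by rewrite inE iA.
Qed.

Lemma meetsT {I : finType} (J : {set I}) :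
  [exists i in [set: I], i \in J] = (J != set0).
Proof. by rewrite meetsE subTset -[setT in LHS]setC0 (inj_eq (@setC_inj _)). Qed.

(** The multiplicity of S is the number of b with fibre S; conversely, take
    y(S) copies of each S as the target of the relation, related to the elements
    of S. *)
Lemma relational_hypergraph_rank {R : realType} {I : finType}
    (f : {set I} -> R) :
  relational f <-> exists y, f = hypergraph_rank R y.
Proof.
split=> [[J [r ->]]|[y ->]].
  pose fiber b : {set I} := [set a | r a b]%SET.
  exists (fun S => #|[set b | fiber b == S]%SET|); apply: funext => A.
  rewrite /relation_fun /hypergraph_rank /nbhd_weight -sum1_card natr_sum.
  rewrite (partition_big fiber (fun S : {set I} => [exists i in A, i \in S])) /=.
    apply: eq_bigr => S meetS; rewrite -sum1_card natr_sum.
    apply: eq_bigl => b; rewrite !inE andbC; case: eqP => //= fib.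
    by move: meetS; rewrite -fib; under eq_existsb do rewrite inE.
  by move=> b; rewrite inE; under [in X in _ -> X]eq_existsb do rewrite inE.
exists {S : {set I} & 'I_(y S)},
  (fun i (s : {S : {set I} & 'I_(y S)}) => i \in tag s).
apply: funext => A; rewrite /relation_fun -sum1_card natr_sum.
rewrite /hypergraph_rank /nbhd_weight.
transitivity (\sum_(S : {set I} | [exists i in A, i \in S])
    \sum_(k < y S) (1 : R)).
  by apply: eq_bigr => S _; rewrite sumr_const card_ord.
rewrite sig_big_dep /=; apply: eq_bigl => s.
by rewrite inE andbT.
Qed.

(** * The base polytope of a hypergraph rank function *)

Lemma basis_vec_simplex {R : realType} {I : finType} (J : {set I})
    (x : {ffun I -> R^o}) :
  [set basis_vec R i | i in [set` J]]%classic x ->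
  [/\ forall i, 0 <= x i, \sum_i x i = 1 & forall i, i \notin J -> x i = 0].
Proof.
case=> j /= jJ <-; split=> [i||i].
- by rewrite ffunE; exact: ler0n.
- under eq_bigr do rewrite ffunE.
  by rewrite (bigD1 j) //= eqxx big1 ?addr0 // => i /negbTE->.
- by rewrite ffunE; case: eqP => // ->; rewrite jJ.
Qed.

Lemma simplexP {R : realType} {I : finType} (J : {set I})
    (x : {ffun I -> R^o}) :
  simplex J x <->
  [/\ forall i, 0 <= x i, \sum_i x i = 1 & forall i, i \notin J -> x i = 0].
Proof.
split=> [[n [p [w [/(_ _)/basis_vec_simplex pJ w_ge0 w1 ->]]]]|[x_ge0 x1 xJ]].
  have xE i : (\sum_k w k *: p k) i = \sum_k w k * p k i.
    by rewrite sum_ffunE; apply: eq_bigr => k _; rewrite ffunE.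
  split=> [i||i iJ].
  - by rewrite xE sumr_ge0 // => k _; rewrite mulr_ge0 //; case: (pJ k).
  - under eq_bigr do rewrite xE.
    rewrite exchange_big /= -[RHS]w1; apply: eq_bigr => k _.
    by rewrite -mulr_sumr; case: (pJ k) => _ -> _; rewrite mulr1.
  - by rewrite xE big1 // => k _; case: (pJ k) => _ _ ->; rewrite ?mulr0.
exists #|J|, (fun k => basis_vec R (enum_val k)), (fun k => x (enum_val k)).
have sumJ (F : I -> R) : (forall i, i \notin J -> F i = 0) ->
    \sum_(k < #|J|) F (enum_val k) = \sum_i F i.
  move=> FJ; rewrite -(big_enum_val F) [RHS](bigID (mem J)) /=.
  by rewrite [X in _ = _ + X]big1 ?addr0.
split=> [k|k||] //; first by exists (enum_val k) => //=; exact: enum_valP.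
  by rewrite sumJ.
apply/ffunP => i; rewrite sum_ffunE.
under eq_bigr do rewrite !ffunE.
rewrite (sumJ (fun j => x j * (i == j)%:R)) => [|j /xJ->]; last by rewrite mul0r.
rewrite (bigD1 i) //= eqxx mulr1 big1 ?addr0 // => j.
by rewrite eq_sym => /negbTE->; rewrite mulr0.
Qed.

(** For c = 0 and J empty the description fails: the simplex of the empty set is
    empty, and so are its dilates, but the zero vector has the listed
    properties. *)
Lemma dilate_simplexP {R : realType} {I : finType} (J : {set I}) (c : R)
    (x : {ffun I -> R^o}) : J != set0 -> 0 <= c ->
  dilate c (@simplex R I J) x <->
  [/\ forall i, 0 <= x i, \sum_i x i = c & forall i, i \notin J -> x i = 0].
Proof.
move=> /set0Pn[j jJ] c_ge0; split=> [[z /simplexP[z_ge0 z1 zJ] <-]|[x_ge0 xc xJ]].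
  split=> [i||i iJ]; last by rewrite ffunE zJ // scaler0.
    by rewrite ffunE mulr_ge0.
  by under eq_bigr do rewrite ffunE; rewrite -mulr_sumr z1 mulr1.
have [c0|c_neq0] := eqVneq c 0.
  exists (basis_vec R j); first by apply/simplexP/basis_vec_simplex; exists j.
  apply/ffunP => i; rewrite c0 scale0r ffunE; apply/esym.
  have x0 : \sum_i x i = 0 by rewrite xc.
  exact: (psumr_eq0P (fun k _ => x_ge0 k) x0).
exists (c^-1 *: x); last by rewrite scalerA divff // scale1r.
apply/simplexP; split=> [i||i iJ]; last by rewrite ffunE xJ // scaler0.
  by rewrite ffunE mulr_ge0 ?invr_ge0.
by under eq_bigr do rewrite ffunE; rewrite -mulr_sumr xc mulVf.
Qed.

(** The hard inclusion is [fractional_hall] applied to a point x of the polytope,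
    with hyperedges as destinations: column J of the plan is the summand of x in
    the dilate of the simplex on J. *)
Lemma base_polytope_hypergraph_rank {R : realType} {I : finType}
    (y : {set I} -> nat) :
  base_polytope (hypergraph_rank R y) =
  minkowski_sum (fun J : {set I} => J != set0)
    (fun J : {set I} => dilate (y J)%:R (@simplex R I J)).
Proof.
have rankT : hypergraph_rank R y [set: I] =
    \sum_(J : {set I} | J != set0) (y J)%:R.
  by apply: eq_bigl => J; rewrite meetsT.
apply/seteqP; split=> x /=.
  case; rewrite rankT => xT xA.
  (* x_i is the total minus the sum over the other coordinates, and the rank
     function is monotone. *)
  have x_ge0 i : 0 <= x i.
    have := xA (~: [set i]); rewrite -(lerD2l (x i)).
    have <- : \sum_i x i = x i + \sum_(j in ~: [set i]) x j.
      by rewrite (bigD1 i) //=; congr (_ + _); apply: eq_bigl => j; rewrite !inE.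
    rewrite xT => xi; rewrite -(lerD2r (hypergraph_rank R y (~: [set i]))) add0r.
    apply: le_trans xi; rewrite -rankT.
    by apply: ler_nbhd_weight => [J|]; rewrite ?ler0n ?subsetT.
  have [t [t_ge0 tJ tx ty]] :=
    fractional_hall _ x _ x_ge0 (fun J => ler0n R (y J)) xA.
  have t0 i : t i set0 = 0 by rewrite tJ // inE.
  (* No capacity is left over, as the deficits are nonnegative and add up to 0. *)
  have tyE (J : {set I}) : J != set0 -> \sum_i t i J = (y J)%:R.
    move=> J0; apply/eqP; rewrite eq_sym -subr_eq0; apply/eqP.
    apply: (psumr_eq0P (P := fun J : {set I} => J != set0)
      (F := fun J => (y J)%:R - \sum_i t i J)) => // [K _|].
      by rewrite subr_ge0.
    rewrite sumrB -xT exchange_big /=; apply/eqP; rewrite subr_eq0; apply/eqP.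
    apply: eq_bigr => i _; rewrite -tx [LHS](bigD1 set0) //= t0 add0r //.
  exists (fun J => [ffun i => t i J]) => [J J0|].
    apply/dilate_simplexP => //; split=> [i||i iJ]; rewrite ?ffunE //.
      by under eq_bigr do rewrite ffunE; exact: tyE.
    exact: tJ.
  apply/ffunP => i; rewrite sum_ffunE -tx (bigD1 set0) //= t0 add0r.
  by apply: eq_bigr => J _; rewrite ffunE.
case=> v vP ->.
have {}vP (J : {set I}) (J0 : J != set0) :=
  (dilate_simplexP J _ (v J) J0 (ler0n R (y J))).1 (vP J J0).
have vE (A : {set I}) :
    \sum_(i in A) (\sum_(J : {set I} | J != set0) v J) i =
    \sum_(J : {set I} | J != set0) \sum_(i in A) v J i.
  by rewrite exchange_big; apply: eq_bigr => i _; rewrite sum_ffunE.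
split=> [|A].
  rewrite rankT; have := vE [set: I].
  rewrite (eq_bigl xpredT) => [->|i]; last by rewrite inE.
  apply: eq_bigr => J J0; have [_ <- _] := vP J J0.
  by apply: eq_bigl => i; rewrite inE.
rewrite vE /hypergraph_rank /nbhd_weight.
rewrite [leLHS]big_mkcond [leRHS]big_mkcond; apply: ler_sum => J _ /=.
case: ifP => [/vP[v_ge0 vy vJ]|_]; last by case: ifP.
have [_|nAJ] := boolP [exists i in A, i \in J].
  rewrite -vy [leLHS]big_mkcond; apply: ler_sum => i _.
  by case: ifP.
by rewrite big1 // => i iA; rewrite vJ //; apply: contra nAJ => iJ;
  apply/exists_inP; exists i.
Qed.

(** * A submodular function is determined by its base polytope *)

Definition base_on {R : realType} {I : finType} (f : {set I} -> R)
    (S : {set I}) (x : I -> R) : Prop :=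
  \sum_(i in S) x i = f S /\
  forall B : {set I}, B \subset S -> \sum_(i in B) x i <= f B.

(** One step of the greedy algorithm gives a new element a the marginal value
    f (a |: S) - f S.  For B containing a, submodularity for B and S bounds this
    by f B - f (B :\ a), so the inequality for B :\ a yields the one for B. *)
Lemma base_on_extend {R : realType} {I : finType} (f : {set I} -> R)
    (S T : {set I}) (x : I -> R) :
  submodular f -> S \subset T -> base_on f S x ->
  exists2 x', base_on f T x' & {in S, x' =1 x}.
Proof.
move=> [_ sub_f]; have [n] := ubnP #|T :\: S|.
elim: n S x => // n IH S x; rewrite ltnS => le_n sST [xS xB].
have [TS0|[a /setDP[aT aS]]] := set_0Vmem (T :\: S).
  have -> : T = S by apply/eqP; rewrite eqEsubset sST andbT -setD_eq0 TS0.
  by exists x.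
pose z i := if i == a then f (a |: S) - f S else x i.
have zx (B : {set I}) : a \notin B -> \sum_(i in B) z i = \sum_(i in B) x i.
  move=> aB; apply: eq_bigr => i iB; rewrite /z.
  by case: eqP iB aB => // -> ->.
have za (B : {set I}) : a \in B ->
    \sum_(i in B) z i = f (a |: S) - f S + \sum_(i in B :\ a) x i.
  move=> aB; rewrite (big_setD1 a) //= zx ?setD11 //.
  by rewrite /z eqxx.
have [|||w wT wS] := IH (a |: S) z.
- apply: leq_trans le_n; apply: proper_card; apply/properP.
  split; first exact/setDS/subsetUr.
  by exists a; rewrite !inE ?eqxx // aS aT.
- by rewrite subUset sub1set aT.
- split=> [|B sB]; first by rewrite za ?setU11 // setU1K // xS subrK.
  have [aB|aB] := boolP (a \in B); last first.
    rewrite zx //; apply: xB; apply/subsetP => i iB.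
    by have := subsetP sB i iB; rewrite !inE; case: eqP iB aB => // -> ->.
  have BI : B :&: S = B :\ a.
    apply/setP => i; rewrite !inE; have := subsetP sB i; rewrite !inE.
    case: eqP => [->|_]; first by rewrite (negbTE aS) andbF.
    by case: (i \in B) => // /(_ isT).
  have BU : B :|: S = a |: S.
    by apply/eqP; rewrite eqEsubset subUset sB subsetUr subUset sub1set
      inE aB subsetUr.
  have := sub_f B S; rewrite BU BI za //.
  have : \sum_(i in B :\ a) x i <= f (B :\ a) by apply: xB; rewrite -BI subsetIr.
  lra.
- exists w => // i iS; rewrite wS ?inE ?iS ?orbT // /z.
  by case: eqP iS aS => // -> ->.
Qed.

(** Run the greedy algorithm through A first, then through the rest of I. *)
Lemma base_polytope_tight {R : realType} {I : finType} (f : {set I} -> R)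
    (A : {set I}) :
  submodular f -> exists2 x, base_polytope f x & \sum_(i in A) x i = f A.
Proof.
move=> sub_f; have [f0 _] := sub_f.
have [|x [xA xB] _] := base_on_extend f _ _ (fun=> 0) sub_f (sub0set A).
  by split=> [|B]; rewrite ?big_set0 ?f0 // subset0 => /eqP->; rewrite big_set0 f0.
have [z [zT zB] zx] := base_on_extend f _ _ x sub_f (subsetT A) (conj xA xB).
exists [ffun i => z i]; last first.
  by rewrite -xA; apply: eq_bigr => i iA; rewrite ffunE zx.
split=> [|B]; under eq_bigr do rewrite ffunE; last exact/zB/subsetT.
by rewrite -zT; apply: eq_bigl => i; rewrite inE.
Qed.

(** By [base_polytope_tight], f A is the maximum of x(A) over the base polytope
    of f. *)
Lemma base_polytope_inj {R : realType} {I : finType} (f g : {set I} -> R) :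
  submodular f -> submodular g -> base_polytope f = base_polytope g -> f = g.
Proof.
move=> sub_f sub_g fg; apply: funext => A; apply/eqP; rewrite eq_le.
apply/andP; split.
  have [x + <-] := base_polytope_tight f A sub_f.
  by rewrite fg => -[_].
have [x + <-] := base_polytope_tight g A sub_g.
by rewrite -fg => -[_].
Qed.

(** * Alternating sums and Moebius inversion *)

(** If A is a proper subset of B, the terms cancel in pairs K, a |: K for any
    fixed a in B outside A. *)
Lemma sum_sign_interval {R : pzRingType} {I : finType} (A B : {set I}) :
  \sum_(K : {set I} | (A \subset K) && (K \subset B)) (-1) ^+ #|K :\: A| =
  (A == B)%:R :> R.
Proof.
have [->|AB] := eqVneq A B.
  under eq_bigl do rewrite andbC -eqEsubset.
  by rewrite big_pred1_eq setDv cards0.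
have [sAB|nAB] := boolP (A \subset B); last first.
  rewrite big1 // => K /andP[AK KB]; case/negP: nAB.
  exact: subset_trans AK KB.
have /properP[_ [a aB aA]] : A \proper B by rewrite properEneq AB.
rewrite (bigID (fun K : {set I} => a \in K)) /=.
rewrite (reindex_onto (fun K => a |: K) (fun K => K :\ a)) /=; last first.
  by move=> K /andP[_ aK]; rewrite setD1K.
rewrite (eq_bigl (fun K : {set I} =>
  ((A \subset K) && (K \subset B)) && (a \notin K))).
  rewrite -big_split big1 //= => K /andP[_ aK].
  have -> : (a |: K) :\: A = a |: (K :\: A).
    by apply/setP => i; rewrite !inE; case: eqP => [->|//]; rewrite aA.
  by rewrite cardsU1 inE (negbTE aK) andbF exprS mulN1r addNr.
move=> K; rewrite setU11 andbT subUset sub1set aB /=.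
have [aK|aK] := boolP (a \in K); last first.
  rewrite setU1K // eqxx !andbT; congr (_ && _); apply/idP/idP => /subsetP AK.
    apply/subsetP => i iA; have := AK i iA; rewrite !inE.
    by case: eqP iA aA => // -> ->.
  by apply/subsetP => i iA; rewrite inE AK ?orbT.
rewrite andbF; apply/negbTE/negP => /andP[_ /eqP KE].
by move: aK; rewrite -KE !inE eqxx.
Qed.

Lemma sum_sign_interval_dual {R : pzRingType} {I : finType} (A B : {set I}) :
  \sum_(K : {set I} | (A \subset K) && (K \subset B)) (-1) ^+ #|B :\: K| =
  (A == B)%:R :> R.
Proof.
rewrite (reindex_inj (@setC_inj _)) /= eq_sym -(inj_eq (@setC_inj _)).
rewrite -sum_sign_interval.
apply: eq_big => [K|K _]; first by
  rewrite subsetC -[in X in _ && X](setCK B) setCS andbC.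
by rewrite !setDE !setCK setIC.
Qed.

Definition alternating_sum {R : pzRingType} {I : finType} (f : {set I} -> R)
    (A : {set I}) : R :=
  \sum_(K : {set I} | A \subset K) (-1) ^+ #|K :\: A| * f K.

(** After exchanging the sums, f K gets the signed count of the B between A and
    K, which vanishes unless K = A. *)
Lemma mobius_inversion {R : pzRingType} {I : finType} (f : {set I} -> R)
    (A : {set I}) :
  \sum_(B : {set I} | A \subset B) alternating_sum f B = f A.
Proof.
rewrite (exchange_big_dep xpredT) //=.
under eq_bigr do rewrite -mulr_suml sum_sign_interval_dual.
rewrite (bigD1 A) //= eqxx mul1r big1 ?addr0 // => K.
by rewrite eq_sym => /negbTE->; rewrite mul0r.
Qed.

(** The indicator that K meets J is 1 minus the indicator that K lies in ~: J.
    Hence y J gets the signed count of the interval from A to I, which is zero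
    for A <> I, minus that of the interval from A to ~: J. *)
Lemma alternating_sum_hypergraph_rank {R : pzRingType} {I : finType}
    (y : {set I} -> nat) (A : {set I}) :
  A != [set: I] -> alternating_sum (hypergraph_rank R y) A = - (y (~: A))%:R.
Proof.
move=> AT; rewrite /alternating_sum /hypergraph_rank /nbhd_weight.
under eq_bigr do rewrite big_mkcond mulr_sumr.
rewrite exchange_big /=.
transitivity (\sum_(J : {set I}) (if J == ~: A then - (y J)%:R else 0 : R)).
  apply: eq_bigr => J _.
  pose sign (K : {set I}) : R := (-1) ^+ #|K :\: A|.
  transitivity (
    (\sum_(K : {set I} | (A \subset K) && (K \subset [set: I])) sign K -
     \sum_(K : {set I} | (A \subset K) && (K \subset ~: J)) sign K) * (y J)%:R).
    rewrite [X in _ - X]big_mkcondr /=.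
    under [X in X - _]eq_bigl do rewrite subsetT andbT.
    rewrite -sumrB mulr_suml; apply: eq_bigr => K _; rewrite meetsE.
    by case: (K \subset _); rewrite /= ?subrr ?subr0 ?mul0r ?mulr0.
  rewrite !sum_sign_interval (negbTE AT) sub0r -(inj_eq (@setC_inj _)) setCK eq_sym.
  by case: eqP => _; rewrite ?mulN1r ?oppr0 ?mul0r.
by rewrite -big_mkcond big_pred1_eq.
Qed.

Lemma meets_neq0 {I : finType} (A J : {set I}) :
  [exists i in A, i \in J] -> J != set0.
Proof. by case/exists_inP => i _ iJ; apply/set0Pn; exists i. Qed.

Lemma hypergraph_rank_integral_alternating {R : realType} {I : finType}
    (y : {set I} -> nat) : integral_alternating (hypergraph_rank R y).
Proof.
split=> [|A].
  by rewrite /hypergraph_rank /nbhd_weight big1 // => J /exists_inP[i]; rewrite inE.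
split=> [|AT]; first by apply: rpred_sum => J _; exact: rpred_nat.
by have := alternating_sum_hypergraph_rank (R := R) y A AT;
  rewrite /alternating_sum => ->; rewrite oppr_le0 ler0n.
Qed.

(** The values f A are recovered by summing over all B the alternating sums and
    removing those with A included in B; the full sum is f of the empty set,
    that is, 0. *)
Lemma integral_alternating_hypergraph_rank {R : realType} {I : finType}
    (f : {set I} -> R) :
  integral_alternating f -> exists y, f = hypergraph_rank R y.
Proof.
move=> [f0 fP].
exists (fun J => Num.truncn (- alternating_sum f (~: J))).
have yE J : J != set0 ->
    (Num.truncn (- alternating_sum f (~: J)))%:R = - alternating_sum f (~: J).
  move=> J0; apply: truncnK; rewrite natrEint; apply/andP; split.
    rewrite rpredN rpred_sum // => K _; have [fK _] := fP K.
    by rewrite rpredM // rpredX // rpredN rpred1.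
  rewrite oppr_ge0; have [_ ->] // := fP (~: J).
  by apply: contra_neq J0 => JT; rewrite -(setCK J) JT setCT.
apply: funext => A; rewrite /hypergraph_rank /nbhd_weight.
under [RHS]eq_bigr => J /meets_neq0 J0 do rewrite yE //.
rewrite sumrN (reindex_inj (@setC_inj _)) /=.
under [in RHS]eq_bigl => B do rewrite meetsE setCK.
under [in RHS]eq_bigr => B _ do rewrite setCK.
have sum0 : \sum_(B : {set I}) alternating_sum f B = 0.
  by rewrite -[RHS]f0 -(mobius_inversion f); apply: eq_bigl => B; rewrite sub0set.
move/eqP: sum0; rewrite (bigID (fun B : {set I} => A \subset B)) /=.
by rewrite mobius_inversion addr_eq0 => /eqP.
Qed.

Theorem proposition19p4 (R : realType) (I : finType) (f : {set I} -> R)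
    (hf : submodular f) :
  (relational f <-> hypergraphic (base_polytope f)) /\
  (relational f <-> integral_alternating f).
Proof.
rewrite !relational_hypergraph_rank; split; split.
- by case=> y ->; exists y; exact: base_polytope_hypergraph_rank.
- case=> y; rewrite -base_polytope_hypergraph_rank => fy; exists y.
  apply: base_polytope_inj hf _ fy.
  by apply: nbhd_weight_submodular => J; exact: ler0n.
- by case=> y ->; exact: hypergraph_rank_integral_alternating.
- exact: integral_alternating_hypergraph_rank.
Qed.
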